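(* Let $c\ge2$ be an integer. When all agents in $N$ have $\{1,c\}$-SUB valuations, every max Nash welfare allocation $X$ is $\frac25$-MMS, i.e. $v_i(X_i)\ge\frac25\,\mathrm{MMS}_i$ for all $i\in N$.
   Context: $N=\{1,\dots,n\}$ is a set of agents and $G$ a finite set of goods; agent $i$ has valuation $v_i:2^G\to\mathbb{R}_{\ge0}$. A valuation $v$ is $\{1,c\}$-SUB if $v(\emptyset)=0$; every marginal gain $v(S\cup\{g\})-v(S)$ with $S\subseteq G$, $g\in G\setminus S$ lies in $\{1,c\}$; and $v(S\cup\{g\})-v(S)\ge v(T\cup\{g\})-v(T)$ for all $S\subseteq T\subseteq G$, $g\in G\setminus T$. An allocation $X=(X_0,X_1,\dots,X_n)$ is a partition of $G$ into $n+1$ (possibly empty) bundles; $X_i$ goes to agent $i\in N$ and $X_0$ is the set of unallocated goods. Let $P_X=\{i\in N:v_i(X_i)>0\}$. $X$ is a max Nash welfare allocation if it maximizes $|P_X|$ over all allocations and, subject to that, maximizes $\prod_{i\in P_X}v_i(X_i)$. The maximin share of agent $i$ is $\mathrm{MMS}_i=\max_X\min_{j\in N}v_i(X_j)$, the maximum being over all allocations $X$. *)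

(* Defs.v *)
From mathcomp Require Import all_boot all_order all_algebra.
From mathcomp Require Import reals.

Set Implicit Arguments.
Unset Strict Implicit.
Unset Printing Implicit Defensive.

Import Order.TTheory GRing.Theory Num.Theory.
Local Open Scope ring_scope.

Definition is_valuation (R : realType) (G : finType) (v : {set G} -> R) : Prop :=
  forall S : {set G}, 0 <= v S.

Definition marginal (R : realType) (G : finType) (v : {set G} -> R)
    (S : {set G}) (g : G) : R :=
  v (g |: S) - v S.

Definition one_c_SUB (R : realType) (G : finType) (c : nat)
    (v : {set G} -> R) : Prop :=
  [/\ v set0 = 0,
      forall (S : {set G}) (g : G), g \notin S ->
        marginal v S g = 1 \/ marginal v S g = c%:R
    & forall (S T : {set G}) (g : G), S \subset T -> g \notin T ->
        marginal v T g <= marginal v S g].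

(* [X (Some i)] is the bundle of agent [i], [X None] the set of unallocated
   goods.  Bundles may be empty, hence finset's [partition], which excludes
   empty blocks, does not apply. *)
Definition is_allocation (G : finType) (n : nat)
    (X : {ffun option 'I_n -> {set G}}) : bool :=
  [forall j, forall k, (j != k) ==> [disjoint X j & X k]]
  && (\bigcup_j X j == [set: G]).

Definition positive_agents (R : realType) (G : finType) (n : nat)
    (v : 'I_n -> {set G} -> R) (X : {ffun option 'I_n -> {set G}}) : {set 'I_n} :=
  [set i | 0 < v i (X (Some i))].

Definition nash_product (R : realType) (G : finType) (n : nat)
    (v : 'I_n -> {set G} -> R) (X : {ffun option 'I_n -> {set G}}) : R :=
  \prod_(i in positive_agents v X) v i (X (Some i)).

Definition max_nash_welfare (R : realType) (G : finType) (n : nat)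
    (v : 'I_n -> {set G} -> R) (X : {ffun option 'I_n -> {set G}}) : Prop :=
  [/\ is_allocation X,
      forall Y : {ffun option 'I_n -> {set G}}, is_allocation Y ->
        (#|positive_agents v Y| <= #|positive_agents v X|)%N
    & forall Y : {ffun option 'I_n -> {set G}}, is_allocation Y ->
        #|positive_agents v Y| = #|positive_agents v X| ->
        nash_product v Y <= nash_product v X].

(* The seed of the minimum is one of its own terms, and the seed 0 of the
   maximum is harmless because valuations are nonnegative and allocations
   exist; so both are the exact minimum and maximum. *)
Definition MMS (R : realType) (G : finType) (n : nat)
    (v : 'I_n -> {set G} -> R) (i : 'I_n) : R :=
  \big[Num.max/0]_(X : {ffun option 'I_n -> {set G}} | is_allocation X)
    \big[Num.min/v i (X (Some i))]_(j < n) v i (X (Some j)).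

Definition approx_MMS (R : realType) (G : finType) (n : nat) (alpha : R)
    (v : 'I_n -> {set G} -> R) (X : {ffun option 'I_n -> {set G}}) : Prop :=
  forall i : 'I_n, alpha * MMS v i <= v i (X (Some i)).

(* Main.v *)
(** A {1,c}-SUB valuation is |S| + (c-1) r(S) for a matroid rank function r.
    Fix an agent i, put x = v_i(X_i), h = r_i(X_i), and let D be the set of
    goods of marginal value c for X_i; then
    v_i(T) <= |T| + (c-1) (h + |T :&: D|) for every bundle T.
    Moving a single good to i never increases the Nash product, which bounds
    the size, the value and the number of D-goods of every other bundle.
    Give each good a weight alpha or beta according to whether it lies in D.
    For a suitable choice, every X_j weighs at most K and X_i less than K, so
    every other allocation has a bundle T_j lighter than K, and lightness
    forces 2 v_i(T_j) <= 5 x.  Plain averaging, with weights c and 1, works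
    unless h <= 1 and X_i has few further goods; in these cases the weight of
    a D-good is cut so that D-goods in excess of h + 1 per bundle are useless. *)

Require Import Defs.
From mathcomp Require Import all_boot all_order all_algebra.
From mathcomp Require Import reals.
From mathcomp Require Import zify.
Import Order.TTheory GRing.Theory Num.Theory.
Local Open Scope ring_scope.

(** * Matroid rank: closure and coloops *)

Section MatroidRank.
Local Open Scope nat_scope.
Variables (G : finType).
Implicit Types (r : {set G} -> nat) (S T C : {set G}).

Definition matroid_rank r : Prop :=
  [/\ r set0 = 0,
      forall S g, g \notin S -> r S <= r (g |: S) <= (r S).+1
    & forall S T g, S \subset T -> g \notin T ->
        r (g |: T) + r S <= r (g |: S) + r T].

(** The complement of the closure of [S]; for an agent holding [S], the goods that would add c. *)
Definition fresh r S : {set G} := [set g | r S < r (g |: S)].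

(** The coloops of the matroid restricted to [S]; for an agent holding [S], the goods whose loss
    costs c. *)
Definition coloops r S : {set G} := [set g in S | r (S :\ g) < r S].

Lemma set_ind_add (P : {set G} -> Prop) :
  P set0 -> (forall g S, g \notin S -> P S -> P (g |: S)) -> forall S, P S.
Proof.
move=> P0 PU S; elim: {S}#|S| {-2}S (erefl #|S|) => [|k IH] S.
  by move/eqP; rewrite cards_eq0 => /eqP ->.
move=> Sk; have /card_gt0P[g gS] : 0 < #|S| by rewrite Sk.
rewrite -(setD1K gS); apply: PU; first by rewrite setD11.
by apply: IH; move: Sk; rewrite (cardsD1 g S) gS => -[].
Qed.

(** By diminishing marginals, only goods fresh for [S] can raise the rank while [T] is added good by
    good. *)
Lemma rank_setU_le r S T :
  matroid_rank r -> r S <= r (S :|: T) <= r S + #|T :&: fresh r S|.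
Proof.
case=> _ rU rsub; elim/set_ind_add: T => [|g T gT IH].
  by rewrite setU0 set0I cards0 addn0 leqnn.
have -> : #|(g |: T) :&: fresh r S| = (g \in fresh r S) + #|T :&: fresh r S|.
  rewrite setIUl; have [gF|gF] := boolP (g \in fresh r S).
    by rewrite (setIidPl _) ?sub1set // cardsU1 inE (negPf gT).
  rewrite (_ : [set g] :&: _ = set0) ?set0U //.
  apply/setP => y; rewrite !inE; case: eqP => // ->.
  by move: gF; rewrite inE => /negPf ->.
rewrite setUCA; have [gST|gST] := boolP (g \in S :|: T).
  by rewrite (setUidPr _) ?sub1set //; lia.
have := rsub S (S :|: T) g (subsetUl _ _) gST.
have := rU _ _ gST.
have gS : g \notin S by apply: contra gST => gS; rewrite inE gS.
have := rU _ _ gS.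
rewrite inE; lia.
Qed.

Lemma rank_le_fresh r S T :
  matroid_rank r -> r T <= r S + #|T :&: fresh r S|.
Proof.
move=> rM; have /andP[_ ST] := rank_setU_le r S T rM.
have /andP[TS _] := rank_setU_le r T S rM.
by rewrite setUC in TS; apply: leq_trans TS ST.
Qed.

Lemma rank_le_card r S : matroid_rank r -> r S <= #|S|.
Proof.
move=> rM; apply: leq_trans (rank_le_fresh r set0 S rM) _.
by case: rM => -> _ _; rewrite add0n subset_leq_card // subsetIl.
Qed.

(** A coloop of [S] raises the rank of the rest of [S], hence of every subset avoiding it; so
    coloops are independent. *)
Lemma card_coloops_le r S C :
  matroid_rank r -> C \subset coloops r S -> #|C| <= r C.
Proof.
case=> _ _ rsub; elim/set_ind_add: C => [|g C gC IH]; first by rewrite cards0.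
rewrite subUset sub1set !inE => /andP[/andP[gS rS] CS].
have CSg : C \subset S :\ g.
  apply/subsetP => y yC; move: (subsetP CS y yC); rewrite !inE => /andP[-> _].
  by rewrite andbT; apply: contraNneq gC => <-.
have := rsub C (S :\ g) g CSg; rewrite setD11 setD1K // => /(_ isT).
have := IH CS; rewrite cardsU1 gC; lia.
Qed.

Lemma coloops_setI_le r S T :
  matroid_rank r -> S :&: T \subset coloops r S -> #|S :&: T| <= r S.
Proof.
move=> rM /(card_coloops_le r S _ rM) H; apply: leq_trans H _.
have /andP[+ _] := rank_setU_le r (S :&: T) S rM.
by rewrite (setUidPr _) ?subsetIl.
Qed.

End MatroidRank.

(** Building [S] good by good, [r] counts the marginals equal to c. As c - 1 > 0, its axioms can be
    read off those of [v]. *)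
Lemma one_c_SUB_rank (R : realType) (G : finType) (c : nat)
    (v : {set G} -> R) : (2 <= c)%N -> one_c_SUB c v ->
  exists2 r, matroid_rank G r &
    forall S : {set G}, v S = (#|S| + c.-1 * r S)%N%:R.
Proof.
move=> hc [v0 v1 vsub].
have vU (S : {set G}) (g : G) : g \notin S ->
    v (g |: S) = v S + 1 \/ v (g |: S) = v S + c%:R.
  by move=> /v1; rewrite /marginal => -[<-|<-]; [left|right]; rewrite addrC subrK.
have [r rE] : exists r : {set G} -> nat, forall S, v S = (#|S| + c.-1 * r S)%N%:R.
  apply: (@fin_all_exists _ (fun=> nat) (fun S k => v S = (#|S| + c.-1 * k)%N%:R)).
  elim/set_ind_add => [|g S gS [k kE]]; first by exists 0%N; rewrite v0 cards0 muln0.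
  case: (vU S g gS) => ->; [exists k|exists k.+1];
    rewrite kE cardsU1 gS ?natr1 -?natrD; congr _%:R; nia.
exists r => //.
have key a b : ((c.-1 * a <= c.-1 * b) = (a <= b))%N by rewrite leq_pmul2l //; lia.
split.
- move: (rE set0); rewrite v0 cards0 add0n => /esym/eqP.
  by rewrite pnatr_eq0 muln_eq0 => /orP[|/eqP //]; lia.
- move=> S g gS; have := vU S g gS; rewrite !rE cardsU1 gS ?natr1 -?natrD.
  have := key (r S) (r (g |: S)); have := key (r (g |: S)) (r S).+1.
  by move=> k1 k2 [] /eqP; rewrite eqr_nat; nia.
- move=> S T g ST gT; have := vsub S T g ST gT.
  have gS : g \notin S by apply: contra gT; apply: (subsetP ST).
  rewrite /marginal lerBlDr addrAC lerBrDr !rE -!natrD ler_nat !cardsU1 gT gS.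
  by rewrite -key; nia.
Qed.

(** * Arithmetic of the weights *)

Section Weights.
Local Open Scope nat_scope.

(* Constraints on another agent's bundle with [t] goods, rank [q] and [d] goods
   of marginal value [c] for the fixed agent, whose value is [x]. *)
Definition transfer_bounded (c x t q d : nat) : Prop :=
  [/\ d <= t, q < t -> t + c.-1 * q <= x.+1, t <= x.+1
    & 0 < d -> c * (t + c.-1 * q) <= c + x
               \/ d <= q <= t /\ t + c.-1 * q <= x + c].

Lemma separating_weights (c s h : nat) :
    2 <= c -> 0 < s -> h <= s -> let x := s + c.-1 * h in
  exists alpha beta K : nat,
    [/\ beta * s < K,
        forall t q d, transfer_bounded c x t q d ->
          alpha * d + beta * (t - d) <= K
      & forall a b, alpha * a + beta * b < K ->
          2 * (c * a + b + c.-1 * h) <= 5 * x].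
Proof.
case: c => [//|e] /= e1 s0 hs; set x := s + e * h.
have xE : x = s + e * h by [].
clearbody x.
have [big|small] := leqP (2 * e.+1 + 2 * (e * h)) (3 * x).
  (* A light bundle has c a + b <= x + c - 1, and the case condition fits the remaining terms into 3
     x. *)
  exists e.+1, 1, (x + e.+1); split.
  - nia.
  - move=> t q d [dt _ tx /= D].
    have [->|d0] := posnP d; first by lia.
    case: (D d0) => [Hy|[/andP[dq qt] Hy]].
      have : e.+1 * t <= e.+1 + x by apply: leq_trans Hy; rewrite leq_mul2l; lia.
      nia.
    nia.
  - move=> a b; lia.
(* Now 3 s + (c - 1) h < 2 c with s >= h, which excludes h >= 2. *)
have h1 : h <= 1 by case: h small xE hs => [|[|h]] //; nia.
have {h1} [h0|h1] : h = 0 \/ h = 1 by lia.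
  rewrite h0 muln0 addn0 in xE small *; subst x.
  (* Here 3 s < 2 c. As alpha = K, a light bundle has no good of D, and a bounded bundle with such a
     good is a singleton. *)
  exists s.+1, 1, s.+1; split; first lia.
  - move=> t q d [dt qt tx /= D].
    have [->|d0] := posnP d; first by lia.
    have t1 : t = 1; last by nia.
    case: (D d0) => [Hy|[/andP[dq qt'] Hy]].
      have : e.+1 * t <= e.+1 + s by apply: leq_trans Hy; rewrite leq_mul2l; lia.
      nia.
    have [/qt|tq] := ltnP q t; nia.
  - case=> [|a] b; nia.
rewrite h1 muln1 in xE small *.
(* Here 3 s <= c. Two goods of D already weigh K, so a light bundle has at most one, and then at
   most x / 2 others. *)
exists x.+1, 2, (2 * x.+1); split; first lia.
- move=> t q d [dt qt tx /= D].
  have [->|d0] := posnP d; first by lia.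
  case: (D d0) => [Hy|[/andP[dq qt'] Hy]].
    have : e.+1 * t <= e.+1 + x by apply: leq_trans Hy; rewrite leq_mul2l; lia.
    move=> Ht; have : t <= 2 by nia.
    nia.
  have [/qt {}qt|tq] := ltnP q t.
    have : q <= 1 by nia.
    nia.
  have : t <= 2 by nia.
  nia.
- case=> [|[|a]] b; nia.
Qed.

Lemma weight_setI (G : finType) (alpha beta : nat) (D S : {set G}) :
  \sum_(g in S) (if g \in D then alpha else beta)
    = alpha * #|S :&: D| + beta * (#|S| - #|S :&: D|).
Proof.
rewrite (big_setID D) /= -cardsD.
rewrite (eq_bigr (fun=> alpha)) => [|g]; last by rewrite inE => /andP[_ ->].
rewrite sum_nat_const mulnC; congr (_ + _).
rewrite (eq_bigr (fun=> beta)) => [|g]; last by rewrite inE => /andP[/negPf ->].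
by rewrite sum_nat_const mulnC.
Qed.

End Weights.

(** * Moving one good in a max Nash welfare allocation *)

Section Transfers.
Variables (R : realType) (G : finType) (n : nat).
Variable v : 'I_n -> {set G} -> R.
Hypothesis v_ge0 : forall i S, 0 <= v i S.
Implicit Types (X Y T : {ffun option 'I_n -> {set G}}) (i j : 'I_n) (g : G).

(** Removing [g] from every other bundle treats goods of other agents and unallocated goods
    alike. *)
Definition give X i g : {ffun option 'I_n -> {set G}} :=
  [ffun k => if k == Some i then g |: X k else X k :\ g].

Lemma allocation_disjoint X k l :
  is_allocation X -> k != l -> [disjoint X k & X l].
Proof. by case/andP => /forallP/(_ k)/forallP/(_ l)/implyP. Qed.

Lemma allocation_mem X g : is_allocation X -> exists k, g \in X k.
Proof.
case/andP => _ /eqP XT; have : g \in \bigcup_j X j by rewrite XT inE.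
by case/bigcupP => k _ gk; exists k.
Qed.

Lemma give_allocation X i g : is_allocation X -> is_allocation (give X i g).
Proof.
move=> aX; apply/andP; split.
  apply/forallP => k; apply/forallP => l; apply/implyP => kl.
  have /pred0P Xkl := allocation_disjoint _ _ _ aX kl.
  apply/pred0P => y; move: (Xkl y); rewrite !ffunE /=.
  case: (eqVneq k (Some i)) => [ki|_]; case: (eqVneq l (Some i)) => [li|_];
    rewrite !inE; first by rewrite ki li eqxx in kl.
  - by case: (y == g); rewrite //= ?andbF.
  - by case: (y == g); rewrite //= ?andbF.
  - by case: (y == g); rewrite //= ?andbF.
rewrite -subTset; apply/subsetP => y _; apply/bigcupP.
have [->|yg] := eqVneq y g; first by exists (Some i) => //; rewrite ffunE eqxx !inE eqxx.
have [k yk] := allocation_mem _ y aX; exists k => //.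
by rewrite ffunE; case: ifP => _; rewrite !inE ?yg yk ?orbT.
Qed.

Lemma nash_product_full X :
  positive_agents v X = setT -> nash_product v X = \prod_i v i (X (Some i)).
Proof. by rewrite /nash_product => ->; apply: eq_bigl => i; rewrite inE. Qed.

Lemma full_gt0 X i : positive_agents v X = setT -> 0 < v i (X (Some i)).
Proof. by move=> full; have := in_setT i; rewrite -full inE. Qed.

Lemma positive_agents_full T X :
    is_allocation T -> max_nash_welfare v X -> (forall i, 0 < v i (T (Some i))) ->
  positive_agents v X = setT.
Proof.
move=> aT [_ maxX _] Tpos.
have Tfull : positive_agents v T = setT by apply/setP => i; rewrite !inE Tpos.
by apply/eqP; rewrite eqEcard subsetT -Tfull maxX.
Qed.

(** If [Y] leaves an agent with value 0, its product vanishes; otherwise it ties with [X] in the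
    number of positive agents. *)
Lemma max_nash_prod X Y :
    max_nash_welfare v X -> positive_agents v X = setT -> is_allocation Y ->
  \prod_i v i (Y (Some i)) <= \prod_i v i (X (Some i)).
Proof.
move=> [_ _ optX] full aY.
have [/forallP Ypos|] := boolP [forall i, 0 < v i (Y (Some i))].
  have Yfull : positive_agents v Y = setT by apply/setP => i; rewrite !inE Ypos.
  rewrite -nash_product_full // -[leRHS]nash_product_full //.
  by apply: optX; rewrite // Yfull full.
rewrite negb_forall => /existsP[i]; rewrite lt0r v_ge0 andbT negbK => /eqP Yi0.
rewrite (bigD1 i) //= Yi0 mul0r prodr_ge0 // => j _; exact: v_ge0.
Qed.

Lemma prod_pair (F : 'I_n -> R) i j : j != i ->
  \prod_k F k = F i * F j * \prod_(k | (k != i) && (k != j)) F k.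
Proof. by move=> ji; rewrite (bigD1 i) //= (bigD1 j) //= mulrA. Qed.

Lemma max_nash_transfer X i j g :
    max_nash_welfare v X -> positive_agents v X = setT -> j != i ->
    g \in X (Some j) ->
  v i (g |: X (Some i)) * v j (X (Some j) :\ g)
    <= v i (X (Some i)) * v j (X (Some j)).
Proof.
move=> mX full ji gXj; have aX : is_allocation X by case: mX.
have := max_nash_prod _ (give X i g) mX full (give_allocation _ _ _ aX).
rewrite !(prod_pair _ _ _ ji) !ffunE eqxx (inj_eq Some_inj) (negPf ji).
set P := \prod_(k < n | _) v k (X (Some k)).
rewrite (_ : \prod_(k < n | _) _ = P).
  by rewrite ler_pM2r // prodr_gt0 // => k _; exact: full_gt0.
apply: eq_bigr => k /andP[ki kj]; rewrite ffunE (inj_eq Some_inj) (negPf ki).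
congr (v k _); apply/setDidPl; rewrite disjoint_sym disjoints1.
have kj' : Some j != Some k by rewrite (inj_eq Some_inj) eq_sym.
by rewrite (disjointFr (allocation_disjoint _ _ _ aX kj') gXj).
Qed.

Lemma max_nash_unallocated X i g :
    max_nash_welfare v X -> positive_agents v X = setT -> g \in X None ->
  v i (g |: X (Some i)) <= v i (X (Some i)).
Proof.
move=> mX full gX0; have aX : is_allocation X by case: mX.
have := max_nash_prod _ (give X i g) mX full (give_allocation _ _ _ aX).
rewrite (bigD1 i) //= [leRHS](bigD1 i) //= !ffunE eqxx.
set P := \prod_(k < n | _) v k (X (Some k)).
rewrite (_ : \prod_(k < n | _) _ = P).
  by rewrite ler_pM2r // prodr_gt0 // => k _; exact: full_gt0.
apply: eq_bigr => k ki; rewrite ffunE (inj_eq Some_inj) (negPf ki).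
congr (v k _); apply/setDidPl; rewrite disjoint_sym disjoints1.
by rewrite (disjointFr (allocation_disjoint _ None (Some k) aX isT) gX0).
Qed.

Lemma sum_bundles X (f : G -> nat) : is_allocation X ->
  (\sum_(j < n) \sum_(g in X (Some j)) f g
    = \sum_(g in \bigcup_(j < n) X (Some j)) f g)%N.
Proof.
move=> aX; rewrite partition_disjoint_bigcup // => k l kl.
by apply: (allocation_disjoint _ _ _ aX); rewrite (inj_eq Some_inj).
Qed.

(** With nothing unallocated, the agents in [X] hold the total weight of [G]. *)
Lemma sum_bundles_le X Y (f : G -> nat) :
    is_allocation X -> is_allocation Y -> X None = set0 ->
  (\sum_(j < n) \sum_(g in Y (Some j)) f g
    <= \sum_(j < n) \sum_(g in X (Some j)) f g)%N.
Proof.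
move=> aX aY X0; rewrite !sum_bundles //.
have -> : \bigcup_(j < n) X (Some j) = setT.
  apply/setP => g; rewrite inE; apply/bigcupP.
  have [[j|] gX] := allocation_mem _ g aX; first by exists j.
  by rewrite X0 inE in gX.
rewrite [leqRHS](big_setID (\bigcup_(j < n) Y (Some j))) /= setTI.
exact: leq_addr.
Qed.

End Transfers.

(** * Transfer bounds for two-valued marginals, and the comparison of weights *)

Section TwoValued.
Variables (R : realType) (G : finType) (n c : nat).
Variables (v : 'I_n -> {set G} -> R) (rk : 'I_n -> {set G} -> nat).
Variable X : {ffun option 'I_n -> {set G}}.
Hypothesis c_ge2 : (2 <= c)%N.
Hypothesis rkM : forall i, matroid_rank G (rk i).
Hypothesis vE : forall i (S : {set G}), v i S = (#|S| + c.-1 * rk i S)%N%:R.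
Hypothesis maxX : max_nash_welfare v X.
Hypothesis full : positive_agents v X = setT.
Implicit Types (i j : 'I_n) (g : G).

Local Notation size i := #|X (Some i)|.
Local Notation high i := (rk i (X (Some i))).
Local Notation value i := (size i + c.-1 * high i)%N.
Local Notation wanted i := (fresh G (rk i) (X (Some i))).

Lemma value_ge0 i S : 0 <= v i S. Proof. by rewrite vE ler0n. Qed.

Local Notation gain i g := (if g \in wanted i then c else 1%N).
Local Notation loss j g :=
  (if g \in coloops G (rk j) (X (Some j)) then c else 1%N).

Lemma transfer_le i j g : j != i -> g \in X (Some j) ->
  (gain i g * value j <= loss j g * (value i + gain i g))%N.
Proof.
move=> ji gXj.
have aX : is_allocation X by case: maxX.
have gXi : g \notin X (Some i).
  have ij : Some j != Some i by rewrite (inj_eq Some_inj).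
  by rewrite (disjointFr (allocation_disjoint _ _ _ _ _ aX ij) gXj).
have := max_nash_transfer _ _ _ _ value_ge0 _ _ _ _ maxX full ji gXj.
rewrite !vE -!natrM ler_nat cardsU1 gXi.
have [_ rU _] := rkM i; have := rU _ _ gXi.
have [_ rUj _] := rkM j; have gD : g \notin X (Some j) :\ g by rewrite setD11.
have := rUj _ _ gD; rewrite setD1K // (cardsD1 g (X (Some j))) gXj.
rewrite !inE gXj /=.
move: (rk i (g |: _)) (rk j (_ :\ g)) (high i) (high j) #|_ :\ g| (size i).
(* With y what [j] keeps, d the gain and e the loss: cancel x y, then add d e to both sides. *)
have exch x y d e : ((x + d) * y <= x * (y + e) -> d * (y + e) <= e * (x + d))%N.
  by rewrite !mulnDl !mulnDr; lia.
move=> a b h q t s ab qb le.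
set d := (if _ then c else _); set e := (if _ then c else _).
move: le; have -> : (1 + s + c.-1 * a = s + c.-1 * h + d)%N.
  rewrite /d; case: ltnP => ?; [rewrite (_ : a = h.+1)|rewrite (_ : a = h)]; lia.
have -> : (1 + t + c.-1 * q = t + c.-1 * b + e)%N.
  rewrite /e; case: ltnP => ?; [rewrite (_ : q = b.+1)|rewrite (_ : q = b)]; lia.
exact: exch.
Qed.

(** Every marginal is at least 1, so [i] would profit from an unallocated good. The argument [i]
    ensures that there is an agent. *)
Lemma unallocated_eq0 i : X None = set0.
Proof.
have aX : is_allocation X by case: maxX.
apply/eqP/negPn/negP => /set0Pn[g gX0].
have gXi : g \notin X (Some i).
  by rewrite (disjointFr (allocation_disjoint _ _ _ None (Some i) aX isT) gX0).
have := max_nash_unallocated _ _ _ _ value_ge0 _ i _ maxX full gX0.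
rewrite !vE ler_nat cardsU1 gXi.
have [_ rU _] := rkM i; have := rU _ _ gXi; nia.
Qed.

Lemma agent_transfer_bounded i j : j != i ->
  transfer_bounded c (value i) (size j) (high j) #|X (Some j) :&: wanted i|.
Proof.
move=> ji; have tr g := transfer_le i j g ji.
have qt := rank_le_card G _ (X (Some j)) (rkM j).
(* A bundle of rank below its size has a non-coloop, whose loss costs [j] only 1. *)
have noncoloop : (high j < size j)%N -> (value j <= (value i).+1)%N.
  move=> lt; have /subsetPn[g gX gC] :
      ~~ (X (Some j) \subset coloops G (rk j) (X (Some j))).
    apply: contraL lt => sub; rewrite -leqNgt -{1}(setIid (X (Some j))).
    by apply: coloops_setI_le; rewrite ?setIid.
  have := tr g gX; rewrite (negPf gC).
  by move: (value j) (value i) => y x; case: ifP => _; nia.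
split => //.
- by rewrite subset_leq_card // subsetIl.
(* If rank equals size, the value of [j] is c times the size, and this factor absorbs a loss of at
   most c. *)
- have [/noncoloop|tq] := ltnP (high j) (size j); first exact/leq_trans/leq_addr.
  have [->//|/card_gt0P[g gX]] := posnP (size j).
  have := tr g gX; have -> : value j = (c * size j)%N.
    have -> : high j = size j by apply/eqP; rewrite eqn_leq qt tq.
    by rewrite -mulSn prednK ?(ltnW c_ge2).
  move: (value i) (size j) => x t le.
  have {le} : (c * (gain i g * t) <= c * (x + gain i g))%N.
    rewrite mulnCA (leq_trans le) // leq_mul2r orbC; case: ifP => _ //; lia.
  by rewrite leq_pmul2l ?(ltnW c_ge2) //; case: ifP => _; nia.
- case/card_gt0P => g; rewrite inE => /andP[gX gW].
  (* Wanted goods that are all coloops are independent, so d <= q; otherwise a wanted non-coloop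
     brings [i] a gain of c and costs [j] only 1. *)
  have [sub|/subsetPn[f]] :=
    boolP (X (Some j) :&: wanted i \subset coloops G (rk j) (X (Some j))).
    right; rewrite coloops_setI_le //=.
    have := tr g gX; rewrite gW qt.
    by move: (value i) (value j) => x y; case: ifP => _; nia.
  rewrite inE => /andP[fX fW] fC; left.
  by have := tr f fX; rewrite fW (negPf fC) mul1n [(c + _)%N]addnC.
Qed.

Lemma exists_bundle_le i T : is_allocation T ->
  exists j, (2%:R * v i (T (Some j)) <= 5%:R * v i (X (Some i))).
Proof.
move=> aT; have aX : is_allocation X by case: maxX.
have s0 : (0 < size i)%N.
  rewrite lt0n cards_eq0; apply/eqP => Xi0.
  have := full_gt0 _ _ _ _ _ i full.
  by rewrite Xi0 vE cards0; case: (rkM i) => -> _ _; rewrite muln0 ltxx.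
have [alpha [beta [K [own others small]]]] :=
  separating_weights _ _ _ c_ge2 s0 (rank_le_card G _ (X (Some i)) (rkM i)).
pose f g := if g \in wanted i then alpha else beta.
have [/existsP[j Tj]|] := boolP [exists j : 'I_n, \sum_(g in T (Some j)) f g < K]%N.
  exists j; rewrite weight_setI in Tj.
  rewrite !vE -!natrM ler_nat; apply: leq_trans (small _ _ Tj).
  rewrite leq_mul2l /=.
  have leaT := subset_leq_card (subsetIl (T (Some j)) (wanted i)).
  have /(leq_mul (leqnn c.-1)) :=
    rank_le_fresh G _ (X (Some i)) (T (Some j)) (rkM i).
  set a := #|_ :&: _| in leaT *; have -> : (c * a = a + c.-1 * a)%N.
    by rewrite -mulSn prednK ?(ltnW c_ge2).
  rewrite mulnDr; move: (c.-1 * _)%N (c.-1 * _)%N (c.-1 * _)%N => p q r; lia.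
rewrite negb_exists => /forallP allT.
have := sum_bundles_le _ _ _ _ f aX aT (unallocated_eq0 i).
suff : (\sum_(j < n) \sum_(g in X (Some j)) f g
        < \sum_(j < n) \sum_(g in T (Some j)) f g)%N by rewrite ltnNge => /negP.
apply: (@leq_trans (\sum_(j < n) K)%N); last first.
  by apply: leq_sum => j _; rewrite leqNgt; exact: allT.
(* Strictness comes from [i], whose own bundle contains no wanted good and so weighs beta s < K. *)
rewrite (bigD1 i) //= [ltnRHS](bigD1 i) //= -addSn; apply: leq_add.
  rewrite weight_setI (_ : X (Some i) :&: wanted i = set0) ?cards0 ?muln0 ?subn0 //.
  apply/setP => g; rewrite !inE; apply/andP => -[gX].
  by rewrite (setUidPr _) ?sub1set // ltnn.
apply: leq_sum => j ji; rewrite weight_setI; apply: others.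
exact: agent_transfer_bounded.
Qed.

End TwoValued.

Theorem theorem7p1 (R : realType) (G : finType) (n : nat) (c : nat)
    (hc : (2 <= c)%N) (v : 'I_n -> {set G} -> R)
    (hval : forall i : 'I_n, is_valuation (v i))
    (hsub : forall i : 'I_n, one_c_SUB c (v i))
    (X : {ffun option 'I_n -> {set G}}) (hX : max_nash_welfare v X) :
  approx_MMS (2 / 5) v X.
Proof.
move=> i.
have [rk rkM] : exists rk : 'I_n -> {set G} -> nat, forall j,
    matroid_rank G (rk j)
    /\ forall S : {set G}, v j S = (#|S| + c.-1 * rk j S)%N%:R.
  have ex j : exists r, matroid_rank G r
      /\ forall S : {set G}, v j S = (#|S| + c.-1 * r S)%N%:R.
    by have [r rM rE] := one_c_SUB_rank _ _ _ _ hc (hsub j); exists r.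
  exact: fin_all_exists ex.
rewrite mulrAC ler_pdivrMr ?ltr0n // mulrC -ler_pdivlMr ?ltr0n //.
apply: bigmax_le => [|T aT].
  by rewrite divr_ge0 ?ler0n // mulr_ge0 ?ler0n //; apply: hval.
(* A minimum is at most each of its terms, so one cheap bundle per allocation suffices. *)
suff [j Tj] : exists j, 2 * v i (T (Some j)) <= 5 * v i (X (Some i)).
  apply: (bigmin_inf j) => //.
  by rewrite ler_pdivlMr ?ltr0n // mulrC [leRHS]mulrC.
have [/forallP Tpos|] := boolP [forall j, 0 < v j (T (Some j))].
  have full := positive_agents_full _ _ _ _ _ _ aT hX Tpos.
  apply: (exists_bundle_le _ _ _ c v rk) => // j; by case: (rkM j).
(* Only the empty bundle has value 0, so what is worthless to [j] is worthless to [i]. *)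
rewrite negb_forall => /existsP[j]; rewrite lt0r hval andbT negbK => /eqP Tj0.
have Tj : T (Some j) = set0.
  apply/eqP; move/eqP: Tj0; have [_ ->] := rkM j.
  by rewrite pnatr_eq0 addn_eq0 cards_eq0 => /andP[].
exists j; rewrite Tj; have [-> _ _] := hsub i.
by rewrite mulr0 mulr_ge0 ?ler0n // hval.
Qed.
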